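(* Let $d \ge 1$, let $E \subseteq \mathbb{R}^d$, and let $\mathbf{p} = (\mathbf{p}_i : E \to \mathbb{R})_{i=1}^d$ be a weakly transversal family. Let $n \in \{1,\dots,d\}$ and for every string of indices $i_1,\dots,i_n$ let $\mathbf{p}_{i_1,\dots,i_n} := (\mathbf{p}_{i_j})_{j=1}^n : E \to \mathbb{R}^n$. Then for every set $F \subseteq E$, $$\frac{n}{d}\,\overline{\dim}_B F \le \max_{1 \le i_1 < \cdots < i_n \le d} \overline{\dim}_B\, \mathbf{p}_{i_1,\dots,i_n}(F)$$ provided $F$ is bounded, and $$\frac{n}{d}\dim_P F \le \max_{1 \le i_1 < \cdots < i_n \le d} \dim_P \mathbf{p}_{i_1,\dots,i_n}(F)$$ (with no boundedness assumption on $F$).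
   Context: For bounded $A \subset \mathbb{R}^m$, let $N(A,\delta)$ be the minimal number of balls of radius $\delta$ needed to cover $A$, and let the upper box dimension be $\overline{\dim}_B A := \limsup_{\delta \to 0} \frac{\log N(A,\delta)}{-\log\delta}$. For arbitrary $A \subseteq \mathbb{R}^m$ the packing dimension is $\dim_P A := \inf\{\sup_{i \ge 1} \overline{\dim}_B A_i : A \subseteq \bigcup_{i=1}^\infty A_i\}$, the infimum being over countable covers of $A$ by bounded sets. Weak transversality. A family $\mathbf{p} = (\mathbf{p}_i)_{i=1}^d$ of functions $\mathbf{p}_i : E \to \mathbb{R}$ on a set $E \subseteq \mathbb{R}^d$, regarded as a map $\mathbf{p}: E \to \mathbb{R}^d$, is weakly transversal if for every bounded set $F \subseteq E$: (i) $\mathbf{p}(F)$ is bounded; and (ii) for every $\delta \in (0,1)$ there exists a natural number $M(\delta)$, where for every $\varepsilon > 0$ there is a constant $c_\varepsilon$ with $M(\delta) \le c_\varepsilon \delta^{-\varepsilon}$ for all $\delta \in (0,1)$, such that: for every $\xi \in \mathbb{R}^d$ there exist $m \le M(\delta)$ points $x_1,\dots,x_m \in \mathbb{R}^d$ with $\mathbf{p}^{-1}(B(\xi,\delta)) \cap F \subseteq \bigcup_{k=1}^m B(x_k,\delta)$. Here $B(x,r)$ denotes the ball of center $x$ and radius $r$. The function $M$ and constants $c_\varepsilon$ may depend on $F$. *)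

(* Defs.v *)
From HB Require Import structures.
From mathcomp Require Import all_boot all_order all_algebra.
From mathcomp Require Import all_classical all_reals all_analysis.

Set Implicit Arguments.
Unset Strict Implicit.
Unset Printing Implicit Defensive.

Import Order.TTheory GRing.Theory Num.Theory.
Import numFieldNormedType.Exports.

Local Open Scope classical_set_scope.
Local Open Scope ring_scope.

(* The library norm (and [ball]) on ['rV[R]_m] is the sup norm, so Euclidean
   balls are defined here. *)
Definition edist (R : realType) (m : nat) (x y : 'rV[R]_m) : R :=
  Num.sqrt (\sum_(i < m) (x 0 i - y 0 i) ^+ 2).

Definition eball (R : realType) (m : nat) (x : 'rV[R]_m) (r : R) :
    set 'rV[R]_m :=
  [set y | edist x y < r].

Definition eballs (R : realType) (m : nat) (s : seq 'rV[R]_m) (r : R) :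
    set 'rV[R]_m :=
  \bigcup_(x in [set` s]) eball x r.

(* The value is [+oo] when no finite cover exists; for bounded [A] the infimum
   is an attained minimum of natural numbers. *)
Definition covering_number (R : realType) (m : nat) (A : set 'rV[R]_m)
    (delta : R) : \bar R :=
  ereal_inf [set (size s)%:R%:E | s in [set s : seq 'rV[R]_m |
    A `<=` eballs s delta]].

(* [lne 0 = -oo], hence the empty set has upper box dimension [-oo]. *)
Definition upper_box_dim (R : realType) (m : nat) (A : set 'rV[R]_m) : \bar R :=
  limf_esup
    (fun delta : R => (lne (covering_number A delta) * ((- ln delta)^-1)%:E)%E)
    (0 : R)^'+.

Definition packing_dim (R : realType) (m : nat) (A : set 'rV[R]_m) : \bar R :=
  ereal_inf [set ereal_sup [set upper_box_dim (C i) | i in [set: nat]]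
    | C in [set C : nat -> set 'rV[R]_m |
        (forall i, bounded_set (C i)) /\ A `<=` \bigcup_i C i]].

Definition family_map (R : realType) (d n : nat) (q : 'I_n -> 'rV[R]_d -> R)
    (x : 'rV[R]_d) : 'rV[R]_n :=
  \row_(j < n) q j x.

(* A family on [E] is represented by total functions; only their values on [E]
   are used, since every [F] below is a subset of [E]. *)
Definition weakly_transversal (R : realType) (d : nat) (E : set 'rV[R]_d)
    (p : 'I_d -> 'rV[R]_d -> R) : Prop :=
  forall F : set 'rV[R]_d, F `<=` E -> bounded_set F ->
    bounded_set (family_map p @` F) /\
    exists M : R -> nat,
      (forall eps : R, 0 < eps -> exists c : R,
         forall delta : R, 0 < delta < 1 ->
           (M delta)%:R <= c * delta `^ (- eps)) /\
      (forall delta : R, 0 < delta < 1 -> forall xi : 'rV[R]_d,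
         exists2 s : seq 'rV[R]_d, (size s <= M delta)%N &
           family_map p @^-1` eball xi delta `&` F `<=` eballs s delta).

Definition subfamily_map (R : realType) (d n : nat) (p : 'I_d -> 'rV[R]_d -> R)
    (i : n.-tuple 'I_d) : 'rV[R]_d -> 'rV[R]_n :=
  family_map (fun j : 'I_n => p (tnth i j)).

Definition increasing_indices (d n : nat) (i : n.-tuple 'I_d) : bool :=
  sorted (fun a b : 'I_d => (a < b)%N) i.

(* Main.v *)
(** Shearer's inequality, applied to the [d] cyclic windows [S] of [n]
consecutive coordinates, gives [|Q|^n <= prod_S |Q_S| <= (max_S |Q_S|)^d] for a
finite set [Q] of grid cells in dimension [d] and its coordinate projections
[Q_S].  Take for [Q] the cells of side about [delta] met by [p(F)].  By weak
transversality the part of [F] lying over a cell is covered by [delta^(-o(1))]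
balls of radius [delta], so the covering number of [F] is at most [|Q|] times
this factor, whereas [|Q_S|] is at most a constant times the covering number of
the corresponding projection of [p(F)].
For the packing dimension, countable covers of the projections by sets of small
box dimension are pulled back to [F] and intersected, over all increasing index
strings and with balls; this is a countable cover of [F] by bounded pieces to
which the box dimension bound applies. *)
Require Import Defs.
From HB Require Import structures.
From mathcomp Require Import all_boot all_order all_algebra.
From mathcomp Require Import all_classical all_reals all_analysis.
From mathcomp Require Import lra ring zify.

Set Implicit Arguments.
Unset Strict Implicit.
Unset Printing Implicit Defensive.

Import Order.TTheory GRing.Theory Num.Theory.
Import numFieldNormedType.Exports.

Local Open Scope ring_scope.

(** * Hölder's inequality for finite sums, Shearer's inequality and cyclic windows *)

Lemma holder_prod (F : realFieldType) (T J : finType) (B : {set J}) (C : F)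
    (x : T -> F) (a : J -> T -> F) :
  (0 < #|B|)%N -> 0 <= C -> (forall t, 0 <= x t) -> (forall j t, 0 <= a j t) ->
  (forall t, x t ^+ #|B| <= C * \prod_(j in B) a j t) ->
  (\sum_t x t) ^+ #|B| <= C * \prod_(j in B) \sum_t a j t.
Proof.
set k := #|B| => k_gt0 C_ge0 x_ge0 a_ge0 x_le.
(* By AM-GM, [x t ^+ k <= D * m t ^+ k] with [D] the right-hand side and weights
   [m t] of sum at most 1; then [\sum_t x t] is at most the largest ratio
   [x t / m t], whose k-th power is at most [D].  No k-th root is needed. *)
have k0 : (0 : F) < k%:R by rewrite ltr0n.
pose A j := \sum_t a j t.
have A_ge0 j : 0 <= A j by apply: sumr_ge0.
pose m t := (\sum_(j in B) a j t / A j) / k%:R.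
have m_ge0 t : 0 <= m t.
  by apply: divr_ge0; [apply: sumr_ge0 => j _; exact: divr_ge0 | exact: ltW].
have D_ge0 : 0 <= C * \prod_(j in B) A j.
  by apply: mulr_ge0 => //; exact: prodr_ge0.
have xm t : x t ^+ k <= C * (\prod_(j in B) A j) * m t ^+ k.
  apply: le_trans (x_le t) _; rewrite -mulrA ler_wpM2l//.
  have -> : \prod_(j in B) a j t
      = \prod_(j in B) A j * \prod_(j in B) (a j t / A j).
    rewrite -big_split/=; apply: eq_bigr => j _.
    (* If [A j = 0], its nonnegative summand [a j t] vanishes too, so the convention [x / 0 = 0]
       does no harm. *)
    have [/eqP A0|An0] := eqVneq (A j) 0; last by rewrite mulrCA divff ?mulr1.
    move: A0; rewrite /A psumr_eq0 => [/allP/(_ t)|i _]; last exact: a_ge0.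
    by rewrite mem_index_enum => /(_ isT)/= /eqP ->; rewrite mul0r mulr0.
  rewrite ler_wpM2l ?prodr_ge0//.
  by apply: leif_AGM => j _; exact: divr_ge0.
have sum_m : \sum_t m t <= 1.
  rewrite /m -mulr_suml ler_pdivrMr// mul1r exchange_big/=.
  rewrite -[k%:R]/(#|B|%:R) -sumr_const; apply: ler_sum => j _.
  rewrite -mulr_suml -/(A j).
  by have [->|An0] := eqVneq (A j) 0; rewrite ?mul0r ?divff.
(* Where [m t = 0], the bound [xm] forces [x t = 0], so the identity survives division by zero. *)
have xz t : x t = x t / m t * m t.
  have [m0|mn0] := eqVneq (m t) 0; last by rewrite mulfVK.
  have := xm t; rewrite m0 expr0n eqn0Ngt k_gt0 mulr0n mulr0 => xk.
  have /eqP : x t ^+ k = 0 by apply/le_anti; rewrite xk exprn_ge0.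
  by rewrite mulr0 expf_eq0 k_gt0 => /eqP.
have zk t : (x t / m t) ^+ k <= C * \prod_(j in B) A j.
  have [m0|mn0] := eqVneq (m t) 0.
    by rewrite m0 invr0 mulr0 expr0n eqn0Ngt k_gt0.
  by rewrite expr_div_n ler_pdivrMr ?exprn_gt0// lt0r mn0 m_ge0.
have [t0 _|T0] := pickP [pred t : T | true]; last first.
  by rewrite big1 ?expr0n ?eqn0Ngt ?k_gt0// => t; have := T0 t.
have [t _ t_max] := @arg_maxP _ F T t0 xpredT (fun t => x t / m t) isT.
have sum_le : \sum_u x u <= x t / m t.
  apply: (@le_trans _ _ (x t / m t * \sum_u m u)); last first.
    apply: ler_piMr => //; exact: divr_ge0.
  rewrite mulr_sumr; apply: ler_sum => u _; rewrite [leLHS]xz ler_wpM2r//.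
  exact: t_max.
apply: le_trans (zk t); apply: lerXn2r => //; rewrite nnegrE.
  exact: sumr_ge0.
exact: divr_ge0.
Qed.

Section Projections.
Variables (I T : finType) (x0 : T).
Implicit Types (S U : {set I}) (Q : {set {ffun I -> T}}).

(* The projections to all [S] share one type: the coordinates outside [S] are
   replaced by the default [x0]. *)
Definition coord_proj S (f : {ffun I -> T}) : {ffun I -> T} :=
  [ffun i => if i \in S then f i else x0].

(** The value [t] of coordinate [a] splits the projection to [a |: S] into disjoint parts. Within a
    part, forgetting the constant coordinate [a] is injective and leaves the projection to [S] of a
    slice of [Q]. *)
Lemma card_coord_proj_setU1 S a Q : a \notin S ->
  #|coord_proj (a |: S) @: Q| =
  (\sum_(t : T) #|coord_proj S @: [set f in Q | f a == t]|)%N.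
Proof.
move=> aS; rewrite -[LHS]sum1_card.
rewrite (partition_big (fun g : {ffun I -> T} => g a) xpredT)//=.
apply: eq_bigr => t _; rewrite sum1dep_card.
rewrite -(@card_in_imset _ _ (coord_proj (~: [set a]))); last first.
  move=> f g; rewrite !inE => /andP[_ /eqP fa] /andP[_ /eqP ga] /ffunP fg.
  apply/ffunP => i; move: (fg i); rewrite !ffunE !inE.
  by have [->|//] := eqVneq i a; rewrite fa ga.
have projC f : coord_proj (~: [set a]) (coord_proj (a |: S) f) = coord_proj S f.
  apply/ffunP => i; rewrite !ffunE !inE.
  by have [->|] := eqVneq i a => //=; rewrite (negbTE aS).
congr #|pred_of_set _|; apply/setP => g; apply/imsetP/imsetP.
- move=> [h]; rewrite inE => /andP[/imsetP[f fQ ->] /eqP fa] ->.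
  exists f; last by rewrite projC.
  by move: fa; rewrite inE fQ /= ffunE !inE eqxx /= => ->.
- move=> [f]; rewrite inE => /andP[fQ /eqP fa] ->.
  exists (coord_proj (a |: S) f); last by rewrite projC.
  by rewrite inE imset_f//= ffunE !inE eqxx fa.
Qed.

(** Induction on the set [U] of retained coordinates, slicing [Q] by a coordinate [a] of [U]. The
    size of a projection keeping [a] is a sum over the slices; any other projection only shrinks on
    a slice. [holder_prod], over the [k] sets containing [a], recombines the slices. *)
Lemma shearer (J : finType) (S : J -> {set I}) (k : nat) Q : (0 < k)%N ->
  (forall i, #|[set j | i \in S j]| = k) ->
  (#|Q| ^ k <= \prod_j #|coord_proj (S j) @: Q|)%N.
Proof.
move=> k_gt0 Sk.
suff gen U : (#|coord_proj U @: Q| ^ k <=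
    \prod_j #|coord_proj (S j :&: U) @: Q|)%N.
  have := gen [set: I]%SET; under eq_bigr do rewrite finset.setIT.
  rewrite card_imset// => f g /ffunP fg; apply/ffunP => i.
  by have := fg i; rewrite !ffunE inE.
have [n] := ubnP #|U|; elim: n => // n IHn in U Q * => ltUn.
have [->|[a aU]] := set_0Vmem U.
  (* For empty [Q] the left-hand side is [0 ^ k], which is 0 because [k] is positive. *)
  have [->|[f fQ]] := set_0Vmem Q; first by rewrite imset0 cards0 exp0n.
  have -> : coord_proj finset.set0 @: Q = [set [ffun=> x0]].
    apply/eqP; rewrite finset.eqEsubset finset.sub1set; apply/andP; split.
      apply/fintype.subsetP => _ /imsetP[g _ ->]; rewrite inE.
      by apply/eqP/ffunP => i; rewrite !ffunE inE.
    by apply/imsetP; exists f => //; apply/ffunP => i; rewrite !ffunE inE.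
  rewrite cards1 exp1n; apply: prodn_gt0 => j; apply/card_gt0P.
  by exists (coord_proj (S j :&: finset.set0) f); exact: imset_f.
rewrite -(finset.setD1K aU); set V := U :\ a.
have aV : a \notin V by rewrite !inE eqxx.
have {ltUn} ltVn : (#|V| < n)%N by move: ltUn; rewrite (cardsD1 a U) aU.
pose Qt t := [set f in Q | f a == t].
pose B := [set j | a \in S j].
have splitU j : j \in B -> #|coord_proj (S j :&: (a |: V)) @: Q| =
    (\sum_(t : T) #|coord_proj (S j :&: V) @: Qt t|)%N.
  rewrite inE => aj; rewrite -card_coord_proj_setU1; last first.
    by rewrite inE negb_and aV orbT.
  rewrite finset.setIUr; congr #|pred_of_set (coord_proj (_ :|: _) @: Q)|.
  by apply/finset.setIidPr; rewrite finset.sub1set.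
pose C := (\prod_(j | j \notin B) #|coord_proj (S j :&: (a |: V)) @: Q|)%N.
rewrite card_coord_proj_setU1// (bigID (mem B))/= -/C mulnC.
rewrite (eq_bigr _ splitU) -(ler_nat rat) natrX natrM natr_sum natr_prod.
under [X in _ <= _ * X]eq_bigr do rewrite natr_sum.
rewrite -{1}(Sk a) -/B.
apply: holder_prod; rewrite ?Sk//.
move=> t; rewrite -natr_prod -natrM -natrX ler_nat.
apply: leq_trans (IHn _ (Qt t) ltVn) _.
rewrite (bigID (mem B))/= mulnC leq_mul2r; apply/orP; right.
apply: leq_prod => j; rewrite inE => aj.
have -> : S j :&: (a |: V) = S j :&: V.
  apply/setP => i; rewrite !inE.
  by case: (eqVneq i a) => // ->; rewrite (negbTE aj).
by apply/subset_leq_card/imsetS/fintype.subsetP => f; rewrite inE => /andP[].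
Qed.

End Projections.

Lemma card_expn_le_proj (d n K : nat) (T : finType) (x0 : T)
    (Q : {set {ffun 'I_d -> T}}) :
  (0 < n <= d)%N ->
  (forall S : {set 'I_d}, #|S| = n -> (#|coord_proj x0 S @: Q| <= K)%N) ->
  (#|Q| ^ n <= K ^ d)%N.
Proof.
case: d Q => [|d] Q /andP[n_gt0 led]; first by rewrite leqNgt n_gt0 in led.
move=> QK.
have card_lt : #|[set i : 'I_d.+1 | (i < n)%N]| = n.
  have <- : [set widen_ord led i | i : 'I_n] = [set i : 'I_d.+1 | (i < n)%N].
    apply/setP => i; rewrite inE; apply/imsetP/idP => [[j _ ->]|ltin].
      exact: (ltn_ord j).
    by exists (Ordinal ltin) => //; exact: val_inj.
  by rewrite card_imset ?card_ord// => i j /(congr1 val) /= /val_inj.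
(* Subtraction is modulo [d.+1], so [W j] is the cyclic window of [n] indices starting at [j]. As
   [j] varies, [i - j] takes each value once, so every [i] lies in exactly [n] windows. *)
pose W (j : 'I_d.+1) := [set i : 'I_d.+1 | ((i - j)%R < n)%N].
apply: (leq_trans (@shearer _ _ x0 _ W n Q n_gt0 _)).
  move=> i; rewrite -[RHS]card_lt -(card_imset _ (can_inj (subKr i))).
  congr #|pred_of_set _|; apply/setP => j; rewrite inE; apply/imsetP/idP.
    by move=> [l]; rewrite !inE => ltl ->.
  by move=> ltj; exists (i - j)%R; [rewrite !inE subKr | rewrite subKr].
rewrite -[d.+1 in leqRHS]card_ord -prod_nat_const; apply: leq_prod => j _.
apply: QK; rewrite -[RHS]card_lt -[RHS](card_imset _ (addIr j)).
congr #|pred_of_set _|; apply/setP => i; rewrite inE; apply/idP/imsetP.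
  by move=> lti; exists (i - j)%R; [rewrite inE | rewrite subrK].
by move=> [l]; rewrite inE => ltl ->; rewrite addrK.
Qed.

Local Open Scope classical_set_scope.

(** * Euclidean balls, grid cells and counting of cell codes *)

Lemma normr_coord_le_edist (R : realType) (m : nat) (x y : 'rV[R]_m) i :
  `|x 0 i - y 0 i| <= Defs.edist x y.
Proof.
rewrite -sqrtr_sqr /Defs.edist ler_wsqrtr// (bigD1 i)//= lerDl.
by apply: sumr_ge0 => j _; exact: sqr_ge0.
Qed.

(** The divisor [m.+1] keeps the bound strict, since [m / m.+1 ^ 2 < 1], and covers [m = 0]. *)
Lemma edist_lt (R : realType) (m : nat) (x y : 'rV[R]_m) (r : R) : 0 < r ->
  (forall i, `|x 0 i - y 0 i| <= r / m.+1%:R) -> Defs.edist x y < r.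
Proof.
move=> r_gt0 xy.
have m1 : (0 : R) < m.+1%:R by rewrite ltr0n.
have r2 : 0 < r ^+ 2 by rewrite exprn_gt0.
rewrite -[ltRHS]gtr0_norm// -sqrtr_sqr ltr_sqrt//.
apply: (@le_lt_trans _ _ (\sum_(i < m) (r / m.+1%:R) ^+ 2)).
  apply: ler_sum => i _; rewrite -[leLHS]real_normK ?num_real//.
  by rewrite lerXn2r ?nnegrE// divr_ge0// ltW.
rewrite sumr_const card_ord -[ltLHS]mulr_natr expr_div_n mulrAC.
rewrite ltr_pdivrMr ?exprn_gt0//.
by rewrite ltr_pM2l// -natrX ltr_nat; nia.
Qed.

(** The code [c u] numbers the cell of length [s] containing [u], counted from [-B]. Boundedness
    makes the set of codes finite, so that Shearer's inequality applies to them. *)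
Lemma exists_quantization (R : realType) (B s : R) : 0 < s ->
  exists K (c : R -> 'I_K.+1), forall u v, `|u| <= B -> `|v| <= B ->
    (c u = c v -> `|u - v| <= s) /\
    (forall L : nat, `|u - v| <= L%:R * s -> (c u <= c v + L)%N).
Proof.
move=> s_gt0; pose K := Num.truncn ((B + B) / s).
pose t u := Num.truncn ((u + B) / s).
have uB u : `|u| <= B -> 0 <= (u + B) / s.
  by rewrite ler_norml => /andP[u1 _]; apply: divr_ge0; [lra|exact: ltW].
have tK u : `|u| <= B -> (t u < K.+1)%N.
  rewrite ltnS ler_norml => /andP[_ u2]; apply: le_truncn.
  by rewrite ler_pM2r ?invr_gt0//; lra.
have t1 u : `|u| <= B -> (t u)%:R * s <= u + B < (t u).+1%:R * s.
  move=> /uB/truncn_itv; rewrite -/(t u) => /andP[].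
  by rewrite ler_pdivlMr// ltr_pdivrMr// => -> ->.
exists K, (fun u => inord (t u)) => u v uB' vB; split.
  move=> /(congr1 val); rewrite /= !inordK ?tK// => tuv.
  have := t1 _ uB'; have := t1 _ vB; rewrite tuv -natr1 mulrDl mul1r.
  move=> /andP[v1 v2] /andP[u1 u2].
  by rewrite ler_norml; apply/andP; split; lra.
move=> L uvL; rewrite /= !inordK ?tK//.
rewrite [leqLHS]/t truncn_le_nat ltr_pdivrMr//.
have := t1 _ vB; rewrite -!natr1 natrD !mulrDl !mul1r => /andP[_ v2].
by move: uvL; rewrite ler_norml => /andP[_ ?]; lra.
Qed.

(** Relative to a fixed member [f0], each coordinate has at most [2L + 1] possible values; adding
    [L] keeps the offset a natural number. *)
Lemma card_bounded_diff (I : finType) (K L : nat)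
    (Z : {set {ffun I -> 'I_K.+1}}) :
  (forall f g i, f \in Z -> g \in Z -> (f i <= g i + L)%N) ->
  (#|Z| <= (L + L).+1 ^ #|I|)%N.
Proof.
move=> ZL; have [->|[f0 f0Z]] := set_0Vmem Z; first by rewrite cards0.
pose h (g : {ffun I -> 'I_K.+1}) : {ffun I -> 'I_(L + L).+1} :=
  [ffun i => inord (g i + L - f0 i)%N].
have shiftK (a b c : nat) : (c <= a + L -> c <= b + L ->
    a + L - c = b + L - c -> a = b)%N by lia.
have shift_lt (a c : nat) : (a <= c + L -> a + L - c < (L + L).+1)%N by lia.
have h_inj : {in Z &, injective h}.
  move=> f g fZ gZ /ffunP fg; apply/ffunP => i; apply/ord_inj.
  have /(congr1 (@nat_of_ord _)) := fg i; rewrite !ffunE.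
  rewrite !inordK ?shift_lt ?ZL//.
  by apply: shiftK; exact: ZL.
by rewrite -(card_in_imset h_inj) (leq_trans (max_card _))// card_ffun card_ord.
Qed.

Lemma normr_coord_le (R : realType) (m : nat) (x : 'rV[R]_m) i :
  `|x 0 i| <= `|x|.
Proof.
rewrite [leRHS]/Num.norm/= mx_normrE.
by apply/bigmax_geP; right; exists (0, i).
Qed.

Lemma card_bigcup_le (T I : finType) (A : I -> {set T}) (c : nat) :
  (forall i, #|A i| <= c)%N -> (#|(\bigcup_i A i)%SET| <= c * #|I|)%N.
Proof.
move=> Ac; apply: (@leq_trans (\sum_i #|A i|)).
  apply: (big_ind2 (fun (X : {set T}) n => #|X| <= n)%N) => //.
    by rewrite cards0.
  by move=> X1 n1 X2 n2 ? ?; rewrite (leq_trans (leq_card_setU _ _))// leq_add.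
by rewrite mulnC -sum_nat_const; apply: leq_sum => i _; exact: Ac.
Qed.

Lemma sorted_tuple_of_set (d n : nat) (S : {set 'I_d}) : #|S| = n ->
  exists2 i : n.-tuple 'I_d, increasing_indices i & S = [set j in i].
Proof.
move=> Sn; have sz : size (enum S) == n by rewrite -cardE Sn.
exists (Tuple sz).
  rewrite /increasing_indices/=; apply: sorted_filter.
    by move=> ? ? ?; exact: ltn_trans.
  rewrite -enumT -[sorted _ _]/(sorted (relpre val ltn) _) -sorted_map.
  by rewrite val_enum_ord; exact: iota_ltn_sorted.
by apply/setP => j; rewrite inE memtE/= mem_enum.
Qed.

(** * Covering numbers of a set and of its projections at one scale *)

Lemma covering_projections (R : realType) (d n : nat)
    (p : 'I_d -> 'rV[R]_d -> R) (F : set 'rV[R]_d) (delta : R) (M K : nat) :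
  (0 < n <= d)%N -> 0 < delta -> bounded_set (family_map p @` F) ->
  (forall xi : 'rV[R]_d, exists2 s : seq 'rV[R]_d, (size s <= M)%N &
     family_map p @^-1` eball xi delta `&` F `<=` eballs s delta) ->
  (forall i : n.-tuple 'I_d, increasing_indices i ->
     exists2 s : seq 'rV[R]_n, (size s <= K)%N &
       subfamily_map p i @` F `<=` eballs s delta) ->
  exists N (s : seq 'rV[R]_d), [/\ (size s <= M * N)%N, F `<=` eballs s delta &
    (N ^ n <= ((4 * d + 5) ^ d * K) ^ d)%N].
Proof.
move=> nd delta_gt0 [B0 [_ pF_bnd]] coverF coverP.
have /pF_bnd {}pF_bnd : B0 < `|B0| + 1 by rewrite ltr_pwDr// ler_norm.
set B := _ + 1 in pF_bnd.
have pB x i : F x -> `|p i x| <= B.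
  move=> Fx; have /pF_bnd : (family_map p @` F) (family_map p x) by exists x.
  by apply: le_trans; have := normr_coord_le (family_map p x) i; rewrite mxE.
(* With this side, a cell lies in the Euclidean ball of radius [delta] about any of its points, by
   [edist_lt]. *)
have s_gt0 : 0 < delta / d.+1%:R by rewrite divr_gt0// ltr0n.
have [Kc [c cP]] := exists_quantization B s_gt0.
pose code x : {ffun 'I_d -> 'I_Kc.+1} := [ffun i => c (p i x)].
pose Q := [set g | `[< exists2 x, F x & g = code x >]]%SET.
have coverQ g : exists s : seq 'rV[R]_d, (size s <= M)%N /\
    [set x | F x /\ code x = g] `<=` eballs s delta.
  have [[y [Fy <-]]|none] := pselect (exists y, F y /\ code y = g); last first.
    by exists [::]; split=> // x Fx; case: none; exists x.
  (* The ball is centred at the image of a point [y] of [F] with code [g]; it contains the images of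
     all points with that code. *)
  have [s sM sP] := coverF (family_map p y).
  exists s; split=> // x [Fx /ffunP xy]; apply: sP; split=> //=.
  apply: edist_lt => // i; rewrite !mxE.
  have [+ _] := cP _ _ (pB _ i Fy) (pB _ i Fx); apply.
  by have := xy i; rewrite !ffunE.
have [t tP] := choice coverQ.
exists #|Q|, (flatten [seq t g | g <- enum Q]); split.
- rewrite size_flatten /shape -map_comp sumnE big_map mulnC -sum_nat_const.
  by rewrite big_enum/=; apply: leq_sum => g _; have [] := tP g.
- move=> x Fx; have [_ /(_ x)] := tP (code x); case=> // y yt xy.
  exists y => //=; apply/flatten_mapP; exists (code x) => //.
  by rewrite mem_enum inE; apply/asboolP; exists x.
apply: (card_expn_le_proj (x0 := ord0)) => // S.
move=> /sorted_tuple_of_set[i incr_i ->].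
have [s sK sP] := coverP i incr_i.
(* The projected codes are sorted by the ball of the cover that contains the projected point. *)
pose A (k : 'I_(size s)) := [set g | `[< exists x, [/\ F x,
  eball (nth 0 s k) delta (subfamily_map p i x) &
  g = coord_proj ord0 [set j in i] (code x)] >]]%SET.
have subA : coord_proj ord0 [set j in i] @: Q \subset (\bigcup_k A k)%SET.
  apply/fintype.subsetP => _ /imsetP[g + ->]; rewrite inE => /asboolP[x Fx ->].
  have [y ys xy] : eballs s delta (subfamily_map p i x) by apply: sP; exists x.
  have ltk : (index y s < size s)%N by rewrite index_mem.
  apply/bigcupP; exists (Ordinal ltk) => //; rewrite inE; apply/asboolP.
  by exists x; split=> //=; rewrite nth_index.
apply: leq_trans (subset_leq_card subA) _.
apply: leq_trans (_ : _ <= (4 * d + 5) ^ d * #|'I_(size s)|)%N _; last first.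
  by rewrite card_ord leq_mul2l sK orbT.
apply: card_bigcup_le => k.
(* Coordinates of two points in a common ball differ by less than [2 * delta], that is
   [L = 2 * d.+1] cell sides, whence [2L + 1 = 4d + 5] values. *)
have -> : (4 * d + 5 = (2 * d.+1 + 2 * d.+1).+1)%N by lia.
rewrite -[X in (_ ^ X)%N](card_ord d); apply: card_bounded_diff => f g j.
rewrite !inE => -[x [Fx xk ->]] [y [Fy yk ->]].
rewrite !ffunE; case: ifPn => // ji.
have [_] := cP _ _ (pB _ j Fx) (pB _ j Fy); apply.
have /tnthP[l ->] : j \in i by rewrite inE in ji.
have := le_lt_trans (normr_coord_le_edist _ _ l) xk.
have := le_lt_trans (normr_coord_le_edist _ _ l) yk.
rewrite !mxE natrM mulrCA -mulrA mulfV ?pnatr_eq0// mulr1.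
rewrite !ltr_norml ler_norml => /andP[? ?] /andP[? ?].
by apply/andP; split; lra.
Qed.

(** * Upper box dimension through covers at small scales *)

Lemma lee_forall_gt (R : realFieldType) (x y : \bar R) :
  (forall t : R, (y < t%:E)%E -> (x <= t%:E)%E) -> (x <= y)%E.
Proof.
case: y => [r||] xy; last 2 first.
- by rewrite leey.
- case: x xy => [s|/(_ 0 (ltNyr _))|]//.
  by move=> /(_ (s - 1) (ltNyr _)); rewrite lee_fin lerBrDl gerDr leNgt ltr01.
apply/lee_addgt0Pr => e e_gt0; rewrite -EFinD; apply: xy.
by rewrite lte_fin ltrDl.
Qed.

Lemma covering_ub_of_upper_box_dim_lt (R : realType) (m : nat)
    (A : set 'rV[R]_m) (t : R) :
  (upper_box_dim A < t%:E)%E ->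
  \forall delta \near (0 : R)^'+, exists2 s : seq 'rV[R]_m,
    (size s)%:R <= delta `^ (- t) & A `<=` eballs s delta.
Proof.
move=> /ereal_inf_lt[_ [V V0 <-] Vt]; near=> delta.
have delta_gt0 : 0 < delta by [].
have delta_lt1 : delta < 1 by near: delta; exact: nbhs_right_lt.
have lnd : 0 < - ln delta by rewrite oppr_gt0 ln_lt0// delta_gt0.
have r_gt0 : 0 < delta `^ (- t) by exact: powR_gt0.
have lne_lt : (lne (covering_number A delta) < lne (delta `^ (- t))%:E)%E.
  rewrite lne_EFin// ln_powR mulNr -mulrN EFinM -lte_pdivrMr//.
  apply: le_lt_trans Vt; apply: ereal_sup_ubound; exists delta => //.
  by near: delta.
have /ereal_inf_lt[_ [s sA <-] sd] :
    (covering_number A delta < (delta `^ (- t))%:E)%E.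
  rewrite lte_lne in lne_lt; first exact: lne_lt.
    rewrite in_itv/= leey andbT; apply: le_ereal_inf_tmp => _ [s _ <-].
    by rewrite lee_fin.
  by rewrite in_itv/= leey andbT lee_fin ltW.
by exists s => //; rewrite ltW.
Unshelve. all: by end_near. Qed.

(** The factor [C] is harmless because [ln C / - ln delta] tends to 0; it costs an arbitrarily small
    [e]. *)
Lemma upper_box_dim_le (R : realType) (m : nat) (A : set 'rV[R]_m) (C t : R) :
  0 < C ->
  (\forall delta \near (0 : R)^'+, exists2 s : seq 'rV[R]_m,
    (size s)%:R <= C * delta `^ (- t) & A `<=` eballs s delta) ->
  (upper_box_dim A <= t%:E)%E.
Proof.
move=> C_gt0 coverA; apply/lee_addgt0Pr => e e_gt0.
pose f (delta : R) := (lne (covering_number A delta) * ((- ln delta)^-1)%:E)%E.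
suff fle : \forall delta \near (0 : R)^'+, (f delta <= (t + e)%:E)%E.
  pose V := [set delta | (f delta <= (t + e)%:E)%E].
  apply: (@le_trans _ _ (ereal_sup (f @` V))).
    by apply: ereal_inf_lbound; exists V.
  by rewrite -EFinD; apply: ge_ereal_sup => _ [delta/= fd <-].
near=> delta.
have delta_gt0 : 0 < delta by [].
have delta_lt1 : delta < 1 by near: delta; exact: nbhs_right_lt.
have lnd : 0 < - ln delta by rewrite oppr_gt0 ln_lt0// delta_gt0.
have r_gt0 : 0 < C * delta `^ (- t) by rewrite mulr_gt0// powR_gt0.
(* This holds as soon as [delta] is at most [exp (- ln C / e)]. *)
have lnC : ln C <= e * - ln delta.
  rewrite mulrN lerNr -ler_pdivlMl// -[leRHS]expRK ler_ln ?posrE ?expR_gt0//.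
  by apply: ltW; near: delta; apply: nbhs_right_lt; exact: expR_gt0.
have [s sd sA] : exists2 s : seq 'rV[R]_m,
    (size s)%:R <= C * delta `^ (- t) & A `<=` eballs s delta by near: delta.
rewrite /f lee_pdivrMr// -EFinM.
apply: (@le_trans _ _ (lne (C * delta `^ (- t))%:E)).
  rewrite lee_lne ?in_itv/= ?leey ?lee_fin ?(ltW r_gt0)//.
    by apply: ge_ereal_inf; exists (size s)%:R%:E; [exists s | rewrite lee_fin].
  by rewrite andbT; apply: le_ereal_inf_tmp => _ [s' _ <-]; rewrite lee_fin.
rewrite lne_EFin// lnM ?posrE ?powR_gt0// ln_powR lee_fin; lra.
Unshelve. all: by end_near. Qed.

(** Supersets [A i] of the projections are allowed so that the packing argument can supply members
    of a cover. *)
Lemma upper_box_dim_projections (R : realType) (d n : nat) (E F : set 'rV[R]_d)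
    (p : 'I_d -> 'rV[R]_d -> R) (A : n.-tuple 'I_d -> set 'rV[R]_n) (t : R) :
  weakly_transversal E p -> (0 < n <= d)%N -> F `<=` E -> bounded_set F ->
  (forall i, increasing_indices i ->
    subfamily_map p i @` F `<=` A i /\ (upper_box_dim (A i) < t%:E)%E) ->
  (upper_box_dim F <= (t * (d%:R / n%:R))%:E)%E.
Proof.
move=> pE nd FE Fbnd pA; have [n_gt0 led] := andP nd.
have nR : (0 : R) < n%:R by rewrite ltr0n.
have [pFbnd [M [Mle Mcover]]] := pE F FE Fbnd.
apply/lee_addgt0Pr => e e_gt0; rewrite -EFinD.
have [c0 {}Mle] := Mle _ e_gt0.
pose c1 : R := `|c0| + 1.
have c1_gt0 : 0 < c1 by rewrite ltr_pwDr.
(* The constant left after taking the [n]-th root of [N ^ n <= ((4 * d + 5) ^ d * K) ^ d]. *)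
pose c2 : R := ((4 * d + 5) ^ d)%:R `^ (d%:R / n%:R).
have c2_gt0 : 0 < c2 by rewrite powR_gt0// ltr0n expn_gt0; lia.
apply: (@upper_box_dim_le _ _ _ (c1 * c2)); first by rewrite mulr_gt0.
have : \forall delta \near (0 : R)^'+, forall i : n.-tuple 'I_d,
    increasing_indices i -> exists2 s : seq 'rV[R]_n,
      (size s)%:R <= delta `^ (- t) & A i `<=` eballs s delta.
  apply: filter_forall => i; have [/pA[_ At]|_] := boolP (increasing_indices i).
    by apply: filterS (covering_ub_of_upper_box_dim_lt At).
  exact: nearW.
move=> nearA; near=> delta.
have delta_gt0 : 0 < delta by [].
have delta_lt1 : delta < 1 by near: delta; exact: nbhs_right_lt.
have delta01 : 0 < delta < 1 by rewrite delta_gt0.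
have coverA : forall i : n.-tuple 'I_d,
    increasing_indices i -> exists2 s : seq 'rV[R]_n,
      (size s)%:R <= delta `^ (- t) & A i `<=` eballs s delta by near: delta.
pose K := Num.truncn (delta `^ (- t)).
have KR : (K%:R : R) <= delta `^ (- t) by rewrite truncn_le powR_ge0.
have coverP i : increasing_indices i -> exists2 s : seq 'rV[R]_n,
    (size s <= K)%N & subfamily_map p i @` F `<=` eballs s delta.
  move=> ii; have [s sd sA] := coverA i ii; exists s.
    by rewrite truncn_ge_nat// powR_ge0.
  by apply: subset_trans sA; have [] := pA i ii.
have [N [s [sM sF NK]]] :=
  covering_projections nd delta_gt0 pFbnd (Mcover _ delta01) coverP.
exists s => //.
have NR : (N%:R : R) <= c2 * delta `^ (- t * (d%:R / n%:R)).
  have -> : (N%:R : R) = (N%:R `^ n%:R) `^ (n%:R^-1).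
    by rewrite -powRrM mulfV ?gt_eqF// powRr1.
  rewrite powRrM -powRM ?powR_ge0// powRrM.
  apply: ge0_ler_powR; rewrite ?nnegrE ?invr_ge0 ?powR_ge0 ?(ltW nR)//.
  rewrite !powR_mulrn ?mulr_ge0 ?powR_ge0//.
  apply: (@le_trans _ _ ((((4 * d + 5) ^ d * K) ^ d)%:R)).
    by rewrite -natrX ler_nat.
  rewrite natrX lerXn2r ?nnegrE ?mulr_ge0 ?powR_ge0// natrM.
  by rewrite ler_wpM2l.
have MR : (M delta)%:R <= c1 * delta `^ (- e).
  apply: le_trans (Mle _ delta01) _; rewrite ler_wpM2r ?powR_ge0//.
  by rewrite (le_trans (ler_norm _))// lerDl.
apply: (@le_trans _ _ ((M delta)%:R * N%:R)); first by rewrite -natrM ler_nat.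
apply: le_trans (ler_pM _ _ MR NR) _ => //.
rewrite mulrACA -powRD; last by rewrite (gt_eqF delta_gt0) implybT.
by rewrite opprD mulNr addrC.
Unshelve. all: by end_near. Qed.

(** * Packing dimension through countable covers *)

Lemma packing_dim_lt_cover (R : realType) (m : nat) (A : set 'rV[R]_m) (t : R) :
  (packing_dim A < t%:E)%E -> exists C : nat -> set 'rV[R]_m,
    A `<=` \bigcup_k C k /\ forall k, (upper_box_dim (C k) < t%:E)%E.
Proof.
move=> /ereal_inf_lt[_ [C [_ AC] <-] Ct]; exists C; split=> // k.
by apply: le_lt_trans Ct; apply: ereal_sup_ubound; exists k.
Qed.

(** Any countable index type can replace [nat]: numbers that decode to no index repeat the piece
    [C i0]. *)
Lemma packing_dim_le (R : realType) (m : nat) (I : countType) (i0 : I)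
    (A : set 'rV[R]_m) (C : I -> set 'rV[R]_m) (x : \bar R) :
  (forall k, bounded_set (C k)) -> A `<=` \bigcup_k C k ->
  (forall k, (upper_box_dim (C k) <= x)%E) -> (packing_dim A <= x)%E.
Proof.
move=> Cbnd AC Cx; pose D (k : nat) := C (odflt i0 (unpickle k)).
apply: ge_ereal_inf; exists (ereal_sup [set upper_box_dim (D k) | k in setT]).
  exists D => //; split=> [k|a /AC[i _ Cia]]; first exact: Cbnd.
  by exists (pickle i) => //; rewrite /D pickleK.
by apply: ge_ereal_sup => _ [k _ <-]; exact: Cx.
Qed.

Lemma packing_dim_projections (R : realType) (d n : nat) (E F : set 'rV[R]_d)
    (p : 'I_d -> 'rV[R]_d -> R) (t : R) :
  weakly_transversal E p -> (0 < n <= d)%N -> F `<=` E ->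
  (forall i : n.-tuple 'I_d, increasing_indices i ->
    (packing_dim (subfamily_map p i @` F) < t%:E)%E) ->
  (packing_dim F <= (t * (d%:R / n%:R))%:E)%E.
Proof.
move=> pE nd FE pF.
have coverP (i : n.-tuple 'I_d) : exists C : nat -> set 'rV[R]_n,
    increasing_indices i -> subfamily_map p i @` F `<=` \bigcup_k C k /\
      forall k, (upper_box_dim (C k) < t%:E)%E.
  have [/pF/packing_dim_lt_cover[C CP]|_] := boolP (increasing_indices i).
    by exists C.
  by exists (fun=> set0).
have [C CP] := choice coverP.
(* An index chooses one covering piece per string and a radius. There are finitely many strings, so
   such indices are countable. *)
pose G (k : {ffun n.-tuple 'I_d -> nat} * nat) := [set x | [/\ F x,
  forall i, increasing_indices i -> C i (k.1 i) (subfamily_map p i x) &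
  `|x| <= k.2%:R]].
have GF k : G k `<=` F by move=> x [].
have Gbnd k : bounded_set (G k).
  exists k.2%:R; split; first exact: num_real.
  by move=> r /ltW kr x [_ _ xk]; exact: le_trans kr.
apply: (@packing_dim_le _ _ _ ([ffun=> 0%N], 0%N) _ G _ Gbnd).
  move=> x Fx.
  have pick (i : n.-tuple 'I_d) : exists k,
      increasing_indices i -> C i k (subfamily_map p i x).
    have [ii|_] := boolP (increasing_indices i); last by exists 0%N.
    by have [/(_ _ (ex_intro2 _ _ x Fx erefl))[k _ Ck] _] := CP i ii; exists k.
  have [f fP] := choice pick.
  exists ([ffun i => f i], (Num.truncn `|x|).+1) => //; split=> //= [i ii|].
    by rewrite ffunE; exact: fP.
  exact/ltW/truncnS_gt.
move=> k.
apply: (@upper_box_dim_projections _ _ _ E _ p (fun i => C i (k.1 i))) => //.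
  exact: subset_trans FE.
move=> i ii; split; last by have [_] := CP i ii.
by move=> _ [x [_ Cx _] <-]; exact: Cx.
Qed.

Theorem proposition1p3 (R : realType) (d : nat) (hd : (1 <= d)%N)
  (E : set 'rV[R]_d) (p : 'I_d -> 'rV[R]_d -> R)
  (hp : weakly_transversal E p)
  (n : nat) (hn : (1 <= n <= d)%N)
  (F : set 'rV[R]_d) (hF : F `<=` E) :
  (bounded_set F ->
    ((n%:R / d%:R)%:E * upper_box_dim F <=
      \big[maxe/-oo]_(i : n.-tuple 'I_d | increasing_indices i)
        upper_box_dim (subfamily_map p i @` F))%E) /\
  ((n%:R / d%:R)%:E * packing_dim F <=
    \big[maxe/-oo]_(i : n.-tuple 'I_d | increasing_indices i)
      packing_dim (subfamily_map p i @` F))%E.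
Proof.
have /andP[n_gt0 _] := hn.
have scale (x : \bar R) (t : R) : (x <= (t * (d%:R / n%:R))%:E)%E ->
    ((n%:R / d%:R)%:E * x <= t%:E)%E.
  move=> xt; rewrite -[n%:R / _]invrK lee_pdivrMl ?invr_gt0 ?divr_gt0 ?ltr0n//.
  by rewrite -EFinM invf_div mulrC.
(* A real [t] strictly above the maximum exceeds every projected dimension strictly, as the covering
   bounds require. *)
split=> [Fbnd|]; apply: lee_forall_gt => t /bigmax_ltP[_ dim_lt]; apply: scale.
  apply: (upper_box_dim_projections hp hn hF Fbnd) => i ii.
  by split; [exact: subset_refl | exact: dim_lt].
exact: (packing_dim_projections hp hn hF).
Qed.
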